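(* Let $q$ be a prime power and let $k,h,w$ be integers with $4\le k\le h$, $w\ge 2$ and $k-w\ge 2$. If $L=L_U$ is an $\mathbb{F}_q$-linear set of rank $k$ in $\mathrm{PG}(1,q^h)$ with one point $P$ of weight $w$ and all other points of the same weight $k-w$, then $L$ has geometric field of linearity $\mathbb{F}_{q^s}$ for some integer $s$ with $s\mid w$, $s>1$, $s\mid h$ and $s\geq k-w$.
   Context: Let $V=\mathbb{F}_{q^h}^2$, also regarded as a $2h$-dimensional vector space over $\mathbb{F}_q$. For nonzero $u\in V$, $\langle u\rangle_{q^h}$ denotes the point of $\mathrm{PG}(1,q^h)=\mathrm{PG}(V)$ determined by $u$. An $\mathbb{F}_q$-linear set of rank $k$ in $\mathrm{PG}(1,q^h)$ is the point set $L_U=\{\langle u\rangle_{q^h}\mid u\in U\setminus\{0\}\}$ defined by a $k$-dimensional $\mathbb{F}_q$-subspace $U$ of $V$; rank and weights refer to the given $U$. The ($\mathbb{F}_q$-)weight of a point $P=\langle u_P\rangle_{q^h}$ in $L_U$ is the $\mathbb{F}_q$-dimension of $U_P=\{0\}\cup\{u\in U\setminus\{0\}\mid \langle u\rangle_{q^h}=\langle u_P\rangle_{q^h}\}$. For $s\mid h$, $L_W$ is called an $\mathbb{F}_{q^s}$-linear set if $W$ is closed under multiplication by $\mathbb{F}_{q^s}$ (i.e. $W$ is an $\mathbb{F}_{q^s}$-subspace of $V$). An $\mathbb{F}_q$-linear set $L_U$ has geometric field of linearity $\mathbb{F}_{q^s}$ if there exists an $\mathbb{F}_{q^s}$-linear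 set $L_W$ (with $W$ an $\mathbb{F}_{q^s}$-subspace of $V$ of any dimension) such that $L_U=L_W$ as point sets. *)

(* Defs.v *)
From HB Require Import structures.
From mathcomp Require Import all_boot all_order all_algebra all_fingroup all_field.

Set Implicit Arguments.
Unset Strict Implicit.
Unset Printing Implicit Defensive.

Import GRing.Theory.
Local Open Scope ring_scope.

(* F plays the role of F_q and L that of F_{q^h}.  The plane L x L carries two
   vector space structures, on convertible carriers: [planeF L] is the
   F-space, of dimension 2h, and [planeL L] is the L-space, of dimension 2. *)
Definition planeF (F : finFieldType) (L : fieldExtType F) : vectType F :=
  (L * L)%type.
Definition planeL (F : finFieldType) (L : fieldExtType F) : vectType L :=
  (L^o * L^o)%type.

Section LinearSets.

Variables (F : finFieldType) (L : fieldExtType F).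

Implicit Types (U W : {vspace planeF L}) (P : {vspace planeL L}).

(* <u>_{q^h}; the points of PG(1, q^h) are these L-subspaces for u != 0. *)
Definition pt (u : planeF L) : {vspace planeL L} := <[(u : planeL L)]>%VS.

(* The point set L_U. *)
Definition linset U P : Prop :=
  exists u : planeF L, [/\ u \in U, u != 0 & P = pt u].

(* P has weight n with respect to U: the set U_P is an F-subspace, of
   dimension n. *)
Definition has_weight U P (n : nat) : Prop :=
  exists2 UP : {vspace planeF L},
    forall u : planeF L,
      u \in UP <-> u = 0 \/ [/\ u \in U, u != 0 & pt u = P]
    & \dim UP = n.

Definition closed_under (E : {subfield L}) W : Prop :=
  forall (a : L) (u : planeF L),
    a \in E -> u \in W -> (a *: (u : planeL L) : planeF L) \in W.

(* F_{q^s} is the subfield E of L of degree s over F, which is unique when it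
   exists; an F_{q^s}-subspace is an F-subspace closed under E. *)
Definition geometric_field_of_linearity U (s : nat) : Prop :=
  exists (E : {subfield L}) (W : {vspace planeF L}),
    [/\ \dim E = s, closed_under E W & forall P, linset U P <-> linset W P].

(* U_P is always an F-subspace, so every point has exactly one weight. *)
Lemma weight_exists U (v : planeF L) :
  v != 0 -> exists n, has_weight U (pt v) n.
Proof.
move=> v0.
pose f (a : L) : planeF L := (a * v.1, a * v.2).
have flin : linear f.
  by move=> c a b; rewrite /f !mulrDl -!scalerAl.
pose fL := GRing.isLinear.Build F L (planeF L) _ f flin.
pose g : {linear L -> planeF L} := HB.pack f fL.
pose X := (U :&: limg (linfun g))%VS.
exists (\dim X), X => // u.
have inl : u \in limg (linfun g) <-> (u : planeL L) \in pt v.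
  split.
    by move=> /memv_imgP[a _ ->]; rewrite lfunE /=; apply/vlineP; exists a.
  move=> /vlineP[a ->]; apply/memv_imgP; exists a; first exact: memvf.
  by rewrite lfunE.
rewrite /X memv_cap; split.
  case/andP=> uU /inl uv; have [->|u0] := eqVneq u 0; [by left|right].
  split=> //; apply/eqP; rewrite /pt eqEdim -memvE uv /=.
  by rewrite !dim_vline; move: u0 v0; do 2!case: eqP.
case=> [->|[uU u0 uv]]; first by rewrite !mem0v.
by rewrite uU; apply/inl; rewrite -uv memv_line.
Qed.

Lemma weight_unique U P n m : has_weight U P n -> has_weight U P m -> n = m.
Proof.
case=> X hX <- [Y hY <-]; congr (\dim _); apply/vspaceP => u.
by apply/idP/idP => [/hX/hY|/hY/hX].
Qed.

End LinearSets.

(* Main.v *)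
From HB Require Import structures.
Require Import Defs.
From mathcomp Require Import all_boot all_order all_algebra all_fingroup all_field.

(** Write P = <p> with p in U, pick r in U outside <p>, and put
    A = {a | a r in U} and B = {b | b p in U}, two F-subspaces of L of
    dimensions k - w and w.  By dimensions U = A r + B p, so the weight of a
    point other than P is the dimension of a subspace of A, through the
    r-coordinate.

    For b in B the point <r + b p> is not P, hence has weight k - w = dim A:
    every a in A occurs as an r-coordinate, that is, a (r + b p) is in U, and so
    a b is in B.  Thus A B <= B ([coords_mul]), and B is a vector space over the
    subfield E generated by A.  As 1 is in A, replacing A by E adds no point:
    <e r + b p> = <r + (b / e) p> for e != 0, and b / e is in B
    ([linset_extend_coords]).  So U and the E-subspace E r + B p have the same
    point set, while s = dim E is at least dim A = k - w >= 2, divides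
    dim B = w because B is an E-space, and divides h because E is a subfield
    of L. *)

Section PointCoordinates.

Set Implicit Arguments.
Unset Strict Implicit.
Import GRing.Theory.
Local Open Scope ring_scope.

Variables (F : finFieldType) (L : fieldExtType F).
Implicit Types (u v p r : planeF L) (U : {vspace planeF L}) (a b e : L)
  (A B : {vspace L}).

(** The vector is the first argument, so that [scaleL v] is the F-linear map from
    L onto the line <v>, to which the image and preimage of F-subspaces apply. *)
Definition scaleL v a : planeF L := a *: (v : planeL L).

Lemma scaleL_is_linear v : linear (scaleL v).
Proof.
move=> c a b; rewrite /scaleL scalerDl; congr (_ + _).
by congr (_, _); rewrite /= /GRing.scale /= -scalerAl.
Qed.

HB.instance Definition _ v :=
  GRing.isLinear.Build F L (planeF L) _ (scaleL v) (scaleL_is_linear v).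

Lemma scaleL1 v : scaleL v 1 = v.
Proof. exact: (@scale1r L (planeL L)). Qed.

Lemma scaleLA v a b : scaleL (scaleL v a) b = scaleL v (b * a).
Proof. exact: (@scalerA L (planeL L)). Qed.

Lemma scaleLDl u v a : scaleL (u + v) a = scaleL u a + scaleL v a.
Proof. exact: (@scalerDr L (planeL L)). Qed.

Lemma scaleL_inj v : v != 0 -> injective (scaleL v).
Proof.
move=> v0 a b /eqP; rewrite -subr_eq0 -linearB /= => /eqP ab0.
apply/eqP; rewrite -subr_eq0; apply: contraNT v0 => ab.
by rewrite -[v]scaleL1 -(mulVf ab) -scaleLA ab0; exact/eqP/(@scaler0 L (planeL L)).
Qed.

Lemma pt_scaleL v a : a != 0 -> pt (scaleL v a) = pt v.
Proof.
move=> a0; apply/eqP; rewrite /pt eqEsubv -!memvE.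
rewrite (_ : _ \in _) /=; last by apply/vlineP; exists a.
apply/vlineP; exists a^-1; change (v = scaleL (scaleL v a) a^-1).
by rewrite scaleLA mulVf // scaleL1.
Qed.

Lemma pt_eq_scaleL u v : pt u = pt v -> exists a, u = scaleL v a.
Proof.
move=> uv; have : (u : planeL L) \in pt v by rewrite -uv memv_line.
by case/vlineP=> a ->; exists a.
Qed.

Definition coords U v : {vspace L} := (linfun (scaleL v) @^-1: U)%VS.

Lemma mem_coords U v a : (a \in coords U v) = (scaleL v a \in U).
Proof. by rewrite /coords -memv_preim lfunE. Qed.

Definition multiples A v : {vspace planeF L} := (linfun (scaleL v) @: A)%VS.

Lemma multiplesP A v u :
  reflect (exists2 a, a \in A & u = scaleL v a) (u \in multiples A v).
Proof.
by apply: (iffP memv_imgP) => -[a aA ->]; exists a => //; rewrite lfunE.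
Qed.

Lemma dim_multiples A v : v != 0 -> \dim (multiples A v) = \dim A.
Proof.
move=> v0; apply: limg_dim_eq; rewrite (_ : lker _ = 0%VS) ?capv0 //.
apply/eqP/lker0P => a b; rewrite !lfunE; exact: scaleL_inj.
Qed.

(** Multiplying by v is an F-isomorphism from [coords U v] onto the vectors of U
    on the line <v>, so a weight can be computed inside L. *)
Lemma weight_dim_coords U v n :
  v != 0 -> has_weight U (pt v) n -> \dim (coords U v) = n.
Proof.
move=> v0 [X hX <-]; rewrite -(dim_multiples _ v0); congr (\dim _).
apply/vspaceP=> u; apply/multiplesP/idP => [|/hX].
  case=> a; rewrite mem_coords => aU ->; apply/hX.
  have [->|a0] := eqVneq a 0; [by left; rewrite linear0 | right; split=> //].
    by apply: contraNneq a0 => va0; apply/eqP/(scaleL_inj v0); rewrite va0 linear0.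
  exact: pt_scaleL.
case=> [->|[uU _ /pt_eq_scaleL[a ua]]]; first by exists 0; rewrite ?mem0v ?linear0.
by exists a; rewrite // mem_coords -ua.
Qed.

Section Frame.

Variables (p r : planeF L) (p0 : p != 0) (pr : forall b, r != scaleL p b).

Lemma frame_eq0 a b : scaleL r a + scaleL p b = 0 -> a = 0.
Proof.
move=> e; apply/eqP; apply: contraT => a0; case/negP: (pr (- (a^-1 * b))).
move/eqP: e; rewrite addr_eq0 -linearN => /eqP /(congr1 (fun v => scaleL v a^-1)).
by rewrite !scaleLA mulVf // scaleL1 mulrN => ->.
Qed.

Lemma frame_inj a b a' b' :
  scaleL r a + scaleL p b = scaleL r a' + scaleL p b' -> a = a'.
Proof.
move=> e; apply/subr0_eq/(@frame_eq0 _ (b - b')).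
by rewrite !linearB /= addrACA -opprD e subrr.
Qed.

Lemma frame_neq0 : r != 0.
Proof. by have := pr 0; rewrite linear0. Qed.

Lemma cap_multiples A B : (multiples A r :&: multiples B p = 0)%VS.
Proof.
apply/eqP; rewrite -subv0; apply/subvP => u; rewrite memv_cap.
case/andP=> /multiplesP[a _ ->] /multiplesP[b _ e].
have -> : a = 0; last by rewrite linear0 mem0v.
by apply: (@frame_eq0 _ (- b)); rewrite linearN /= e subrr.
Qed.

(** The right-hand side is a direct sum contained in U, so the weights of the two
    points adding up to the rank forces equality. *)
Lemma multiples_decomposition U :
    (\dim (coords U r) + \dim (coords U p))%N = \dim U ->
  U = (multiples (coords U r) r + multiples (coords U p) p)%VS.
Proof.
move=> dimU; apply/esym/eqP.
rewrite eqEdim dimv_disjoint_sum ?cap_multiples // !dim_multiples ?frame_neq0 //.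
rewrite {1}dimU leqnn andbT subv_add.
by apply/andP; split; apply/subvP => u /multiplesP[a]; rewrite mem_coords => + ->.
Qed.

(** Only ratios of coordinates matter for points.  A vector e r + b p with e != 0
    has the same point as r + (b / e) p, whose r-coordinate 1 lies in A and
    whose p-coordinate stays in the E-space B. *)
Lemma linset_extend_coords A B (E : {subfield L}) :
    1 \in A -> (A <= E)%VS -> (E * B <= B)%VS -> forall P,
  linset (multiples A r + multiples B p)%VS P
    <-> linset (multiples E r + multiples B p)%VS P.
Proof.
move=> A1 AE EB P; split.
  case=> u [uU u0 ->]; exists u; split=> //.
  by apply: subvP uU; rewrite addvS // limgS.
case=> u [/memv_addP[_ /multiplesP[e eE ->] [_ /multiplesP[b bB ->] ->]] u0 ->].
have [e0|e0] := eqVneq e 0.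
  move: u0; rewrite e0 linear0 add0r => u0.
  exists (scaleL p b); split=> //; rewrite -[X in X \in _]add0r memv_add ?mem0v //.
  by apply/multiplesP; exists b.
rewrite -(pt_scaleL _ (invr_neq0 e0)).
set v := _ + _ in u0 *; exists (scaleL v e^-1); split=> //; last first.
  apply: contraNneq u0 => eu0; rewrite -[v]scaleL1 -(mulfV e0) -scaleLA eu0.
  exact/eqP/(@scaler0 L (planeL L)).
rewrite scaleLDl !scaleLA mulVf // memv_add //; apply/multiplesP; first by exists 1.
by exists (e^-1 * b) => //; apply/(subvP EB)/memv_mul; first rewrite memvV.
Qed.

Lemma closed_under_multiples (E : {subfield L}) B :
  (E * B <= B)%VS -> closed_under E (multiples E r + multiples B p)%VS.
Proof.
move=> EB a _ aE /memv_addP[_ /multiplesP[e eE ->] [_ /multiplesP[b bB ->] ->]].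
change (scaleL (scaleL r e + scaleL p b) a \in
  (multiples E r + multiples B p)%VS).
rewrite scaleLDl !scaleLA memv_add //; apply/multiplesP.
  by exists (a * e) => //; apply: memvM.
by exists (a * b) => //; apply/(subvP EB)/memv_mul.
Qed.

(** For b with b p in U, the vectors of U on the line of r + b p inject into
    [coords U r] by their r-coordinate.  Equality of weights makes this injection
    onto: a (r + b p) is in U whenever a r is, and subtracting a r leaves
    (a b) p in U. *)
Lemma coords_mul U :
    (\dim (coords U r) + \dim (coords U p))%N = \dim U -> r \in U ->
    (forall u, u \in U -> (forall b, u != scaleL p b) ->
       \dim (coords U u) = \dim (coords U r)) ->
  (coords U r * coords U p <= coords U p)%VS.
Proof.
move=> dimU rU hQ; apply/prodvP => a b aA bB.
set u := r + scaleL p b.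
have uU : u \in U by rewrite memvD // -mem_coords.
have up c : u != scaleL p c.
  apply/negP => /eqP uc; case/eqP: (pr (c - b)).
  by rewrite linearB /= -uc addrK.
have sub : (coords U u <= coords U r)%VS.
  apply/subvP => c; rewrite mem_coords {1}(multiples_decomposition dimU).
  case/memv_addP=> _ /multiplesP[a' a'A ->] [_ /multiplesP[b' _ ->]].
  by rewrite scaleLDl scaleLA => /frame_inj ->.
have /eqP eqA : coords U u == coords U r by rewrite eqEdim sub hQ /=.
move: (aA); rewrite -eqA !mem_coords scaleLDl scaleLA => uaU.
rewrite -(addKr (scaleL r a) (scaleL p _)) memvD // memvN.
by rewrite -mem_coords.
Qed.

End Frame.

End PointCoordinates.

Theorem mainTheorem1
  (F : finFieldType) (L : fieldExtType F) (k h w : nat)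
  (hh : \dim {:L} = h)
  (hk4 : 4 <= k) (hkh : k <= h) (hw : 2 <= w) (hkw : 2 <= k - w)
  (U : {vspace planeF L}) (hU : \dim U = k)
  (P : {vspace planeL L}) (hP : linset U P) (hPw : has_weight U P w)
  (hQw : forall Q : {vspace planeL L},
     linset U Q -> Q <> P -> has_weight U Q (k - w)) :
  exists s : nat,
    [/\ geometric_field_of_linearity U s, s %| w, 1 < s, s %| h & k - w <= s].
Proof.
case: hP hPw hQw => p [pU p0 ->{P}] hPw hQw.
have dimB := weight_dim_coords p0 hPw.
have [r rU pr] : exists2 r, r \in U & forall b, r != scaleL p b.
  (* The vectors of U on <p> form a space of dimension w < k. *)
  have : ~~ (U <= multiples (coords U p) p)%VS.
    apply/negP => /dimvS; rewrite dim_multiples // dimB hU => kw.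
    by move: hkw; rewrite (eqP (kw : _ - _ == 0)).
  case/subvPn=> r rU rB; exists r => // b; apply: contraNneq rB => rb.
  by apply/multiplesP; exists b; rewrite // mem_coords -rb.
have dimQ u : u \in U -> (forall b, u != scaleL p b) ->
    \dim (coords U u) = k - w.
  move=> uU up; have u0 := frame_neq0 up.
  apply: (weight_dim_coords u0); apply: hQw; first by exists u.
  by case/pt_eq_scaleL=> b ub; case/eqP: (up b).
have dimA := dimQ r rU pr.
have dimU : \dim (coords U r) + \dim (coords U p) = \dim U.
  have wk : w <= k by rewrite ltnW // -subn_gt0; apply: ltnW.
  by rewrite dimA dimB hU subnK.
have AB : (coords U r * coords U p <= coords U p)%VS.
  by apply: (coords_mul p0 pr dimU rU) => u uU up; rewrite dimA dimQ.
pose E : {subfield L} := agenv_aspace (coords U r).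
have AE : (coords U r <= E)%VS := sub_agenv _.
have EB : (E * coords U p <= coords U p)%VS := agenv_modl AB.
have sE : k - w <= \dim E by rewrite -dimA dimvS.
exists (\dim E); split=> //.
- exists E, (multiples E r + multiples (coords U p) p)%VS; split=> //.
    exact: closed_under_multiples.
  rewrite [U in linset U](multiples_decomposition p0 pr dimU).
  apply: linset_extend_coords => //.
  by rewrite mem_coords scaleL1.
- by rewrite -dimB field_module_dimS.
- exact: leq_trans sE.
- by rewrite -hh field_dimS // subvf.
Qed.
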